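(* Let $0<T_1<T_2$ and $0<\delta<T_2-T_1$. Let the set $Z$ and the operators $A=A_{\vec\alpha}$, $\vec\alpha\in Z$, satisfy the hypotheses (H) stated in the context. Let the nonlinear operator $N$ be such that the evolution equation $\partial_t u=Au+Nu$ preserves the spatial mean of solutions. Assume there exist $p>1$, $\tilde p\ge 0$, $q>0$, $s\ge 0$, $c>0$ and $\eta>0$ such that for all $u_0\in H^{s+\tilde p}_0$ with $\|u_0\|_{H^{s+\tilde p}}\le\eta$ and all $\vec\alpha\in Z$, the estimate $$\|S_D(T)u_0\|_{H^{s+p}}\le c\,\|u_0\|_{H^s}\,\|u_0\|_{H^{s+\tilde p}}^{q}\qquad( * )$$ holds for all $T\in W_{p,\delta}$. Then there exists $r_0>0$ such that if $u$ is a smooth, nontrivial, mean-zero time-periodic solution of $\partial_t u=Au+Nu$ (for any $\vec\alpha\in Z$) with temporal period $T\in W_{p,\delta}$, then $$\inf_{t\in[0,T]}\|u(\cdot,t)\|_{H^{s+\tilde p}}\ge r_0.\qquad( ** )$$ Furthermore, if $( * )$ holds for every $T\in W_p$, then for every $T\in W_p$ there exists $r_0>0$ such that if $u$ is a nontrivial mean-zero time-periodic solution of $\partial_t u=Au+Nu$ (for any $\vec\alpha\in Z$) with temporal period $T$, then $( ** )$ holds.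
   Context: All functions are $2\pi$-periodic in $x\in\mathbb{R}$. $H^s$ is the usual spatially periodic Sobolev space and $H^s_0$ is the subspace of mean-zero functions. $\mathcal{F}$ denotes the Fourier transform (Fourier coefficients, or symbol of a Fourier multiplier), with variable $k\in\mathbb{Z}$. Hypotheses (H): $M\in\mathbb{N}$, $M\ge 2$; $r_1>r_2>\dots>r_M>0$ are real; $Z_m\subseteq\mathbb{R}$ is bounded for each $m\in\{1,\dots,M\}$; $Z=Z_1\times\dots\times Z_M$, with elements $\vec\alpha=(\alpha_1,\dots,\alpha_M)$. There exist $\beta_1,\beta_2>0$ such that $|\alpha_1|>\beta_1$ for all $\alpha_1\in Z_1$, and $\left|\sum_{m=1}^M\alpha_m k^{r_m}\right|\ge\beta_2$ for all $\vec\alpha\in Z$ and all $k\in\mathbb{Z}\setminus\{0\}$. Given $\vec\alpha\in Z$, the linear operator $A$ is defined by its symbol $\mathcal{F}(A)(k)=i\sum_{m=1}^M\alpha_m k^{r_m}$, $k\in\mathbb{Z}$. (Here $k^{r_m}$ for negative $k$ is understood as a real number with $|k^{r_m}|=|k|^{r_m}$, e.g. $r_m$ an integer.) $S_L(t)=e^{At}$ is the linear solution operator. For the solution $u$ of $\partial_tu=Au+Nu$ with $u(\cdot,0)=u_0$, the Duhamel operator is $S_D(t)u_0=\int_0^t e^{A(t-\tau)}N(u(\cdot,\tau))\,d\tau$, so that $u(\cdot,t)=S_L(t)u_0+S_D(t)u_0$; the assumption $( * )$ includes that the solution with data $u_0$ exists up to time $T$ so that $S_D(T)u_0$ is well defined.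 Preservation of the mean means $\int_0^{2\pi}u(x,t)\,dx=\int_0^{2\pi}u_0(x)\,dx$. A time-periodic solution with temporal period $T$ is one with $u(\cdot,t+T)=u(\cdot,t)$. Sets of periods: for $p>1$ and $0<\delta'<T_2-T_1$, $W_{p,\delta'}\subseteq[T_1,T_2]$ denotes a set with Lebesgue measure $\mu(W_{p,\delta'})>T_2-T_1-\delta'$ such that $I-S_L(T)$ has trivial kernel on mean-zero functions for all $T\in W_{p,\delta'}$, $\vec\alpha\in Z$, and for which there is $c_1>0$ such that for all $\vec\alpha\in Z$, $k\in\mathbb{Z}\setminus\{0\}$, $T\in W_{p,\delta'}$, $$\left|\mathcal{F}(I-S_L(T))^{-1}(k)\right|=\left|1-e^{T\mathcal{F}(A)(k)}\right|^{-1}<c_1|k|^p.$$ $W_p=\bigcup_{n=2}^\infty W_{p,(T_2-T_1)/n}$. *)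

(* Defs.v *)
From HB Require Import structures.
From mathcomp Require Import all_boot all_order all_algebra.
From mathcomp Require Import all_classical all_reals all_analysis.
From mathcomp Require Import measurable_realfun complex.

Set Implicit Arguments.
Unset Strict Implicit.
Unset Printing Implicit Defensive.
Import Order.TTheory GRing.Theory Num.Theory.
Import numFieldNormedType.Exports.

Local Open Scope classical_set_scope.
Local Open Scope complex_scope.
Local Open Scope ring_scope.

Section ComplexCalculus.
Context {R : realType}.

Definition cexp (z : R[i]) : R[i] :=
  (expR (complex.Re z) * cos (complex.Im z))
  +i* (expR (complex.Re z) * sin (complex.Im z)).

(* R-valued modulus; the norm of R[i] as a numDomainType takes values in R[i] *)
Definition cabs (z : R[i]) : R :=
  Num.sqrt (complex.Re z ^+ 2 + complex.Im z ^+ 2).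

Definition cintegral (D : set R) (f : R -> R[i]) : R[i] :=
  (\int[lebesgue_measure]_(x in D) complex.Re (f x))
  +i* (\int[lebesgue_measure]_(x in D) complex.Im (f x)).

Definition is_cderive (f : R -> R[i]) (t : R) (l : R[i]) : Prop :=
  is_derive t (1 : R) (fun x => complex.Re (f x)) (complex.Re l) /\
  is_derive t (1 : R) (fun x => complex.Im (f x)) (complex.Im l).

Definition ccontinuous_on (D : set R) (f : R -> R[i]) : Prop :=
  {within D, continuous (fun x => complex.Re (f x))} /\
  {within D, continuous (fun x => complex.Im (f x))}.

End ComplexCalculus.

Section PeriodicSobolev.
Context {R : realType}.

(* Periodic distributions are represented by their Fourier coefficients; no
   growth condition is imposed. *)
Definition pdistr : Type := int -> R[i].

Definition fourier (f : R -> R[i]) : pdistr := fun k =>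
  ((2 * pi)^-1)%:C *
  cintegral `[0, 2 * pi] (fun x => f x * cexp (0 -i* (k%:~R * x))).

(* The norm of H^s, equal to +oo outside H^s. *)
Definition hnorm (s : R) (a : pdistr) : \bar R :=
  ((\esum_(k in [set: int])
      ((1 + k%:~R ^+ 2) `^ s * cabs (a k) ^+ 2)%:E) `^ (2^-1))%E.

Definition fun_hnorm (s : R) (f : R -> R[i]) : \bar R := hnorm s (fourier f).

Definition periodicL2 (f : R -> R[i]) : Prop :=
  [/\ forall x, f (x + 2 * pi) = f x,
      measurable_fun setT (fun x => complex.Re (f x)),
      measurable_fun setT (fun x => complex.Im (f x)) &
      lebesgue_measure.-integrable `[0, 2 * pi]
        (fun x => (cabs (f x) ^+ 2)%:E)].

(* Only used for s >= 0, where H^s consists of square-integrable functions. *)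
Definition sobolev (s : R) : set (R -> R[i]) :=
  [set f | periodicL2 f /\ (fun_hnorm s f < +oo)%E].

Definition total_mean (f : R -> R[i]) : R[i] := cintegral `[0, 2 * pi] f.

Definition sobolev0 (s : R) : set (R -> R[i]) :=
  sobolev s `&` [set f | total_mean f = 0].

(* Equality of functions as elements of H^s. *)
Definition ae_eq_fun (f g : R -> R[i]) : Prop :=
  {ae @lebesgue_measure R, forall x, f x = g x}.

(* Real-valued and complex-valued equations are treated uniformly. *)
Variant scalars := RealScalars | ComplexScalars.

Definition valued_in (K : scalars) (f : R -> R[i]) : Prop :=
  match K with
  | RealScalars => forall x, complex.Im (f x) = 0
  | ComplexScalars => True
  end.

Definition smooth2 (g : R -> R -> R) : Prop :=
  exists D : nat -> nat -> R -> R -> R,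
    D 0%N 0%N = g /\
    forall i j,
      continuous (fun z : R * R => D i j z.1 z.2) /\
      forall t x,
        is_derive t (1 : R) (fun t' => D i j t' x) (D i.+1 j t x) /\
        is_derive x (1 : R) (D i j t) (D i j.+1 t x).

(* A space-time function u is curried with time first: u t x is u(x,t). *)
Definition smooth (u : R -> R -> R[i]) : Prop :=
  smooth2 (fun t x => complex.Re (u t x)) /\
  smooth2 (fun t x => complex.Im (u t x)).

End PeriodicSobolev.

Section EvolutionEquation.
Context {R : realType} (M : nat).
Implicit Types (alpha : 'I_M -> R) (Z : set ('I_M -> R)).

(* kpow is a real version of k |-> k^r on the integers: the usual power for
   k >= 0, with an arbitrary choice of sign for each negative k. *)
Definition real_power (r : R) (kpow : int -> R) : Prop :=
  (forall k : int, 0 <= k -> kpow k = k%:~R `^ r) /\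
  (forall k : int, `|kpow k| = `|k%:~R| `^ r).

Definition box (Zm : 'I_M -> set R) : set ('I_M -> R) :=
  [set alpha | forall m, Zm m (alpha m)].

Record dispersion_hypotheses (r : 'I_M -> R) (kpow : 'I_M -> int -> R)
    (Zm : 'I_M -> set R) : Prop := {
  two_le_M : (2 <= M)%N ;
  r_decreasing : forall m n : 'I_M, (m < n)%N -> r n < r m ;
  r_positive : forall m, 0 < r m ;
  kpow_power : forall m, real_power (r m) (kpow m) ;
  Zm_bounded : forall m, bounded_set (Zm m) ;
  alpha1_away : exists2 beta1 : R, 0 < beta1 &
    forall (m : 'I_M) (a : R), m = 0%N :> nat -> Zm m a -> beta1 < `|a| ;
  symbol_away : exists2 beta2 : R, 0 < beta2 &
    forall alpha (k : int), box Zm alpha -> k != 0 ->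
      beta2 <= `|\sum_(m < M) alpha m * kpow m k| }.

Variable kpow : 'I_M -> int -> R.

Definition symbolA alpha (k : int) : R[i] :=
  0 +i* (\sum_(m < M) alpha m * kpow m k).

Definition opA alpha (a : pdistr) : pdistr := fun k => symbolA alpha k * a k.

Definition symbolSL alpha (t : R) (k : int) : R[i] :=
  cexp (t%:C * symbolA alpha k).

Definition opSL alpha (t : R) (a : pdistr) : pdistr :=
  fun k => symbolSL alpha t k * a k.

Section Nonlinear.
(* Nu is allowed to be a distribution: for u in H^s with s small, expressions
   such as u u_x need not be functions. *)
Variables (K : scalars) (sigma : R) (N : (R -> R[i]) -> @pdistr R).

(* u in C([a,b]; H^sigma) and the equation holds, in the sense of
   distributions in x, classically in time for each Fourier mode. *)
Definition solution_on alpha (a b : R) (u : R -> R -> R[i]) : Prop :=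
  [/\ forall t, t \in `[a, b] -> sobolev sigma (u t) /\ valued_in K (u t),
      forall t0, t0 \in `[a, b] ->
        hnorm sigma (fourier (u t) \- fourier (u t0))
          @[t --> within `[a, b] (nbhs t0)] --> 0%E,
      forall k, ccontinuous_on `[a, b] (fun t => N (u t) k) &
      forall t k, t \in `]a, b[ ->
        is_cderive (fun t' => fourier (u t') k) t
          (opA alpha (fourier (u t)) k + N (u t) k)].

Definition time_periodic_solution alpha (T : R) (u : R -> R -> R[i]) : Prop :=
  (forall a b, a < b -> solution_on alpha a b u) /\
  (forall t, ae_eq_fun (u (t + T)) (u t)).

Definition preserves_mean Z : Prop :=
  forall alpha (T : R) u, Z alpha -> 0 < T -> solution_on alpha 0 T u ->
    forall t, t \in `[0, T] -> total_mean (u t) = total_mean (u 0).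

(* S_D(T) u_0 for u_0 = u(0), where u is the solution with data u_0. *)
Definition opSD alpha (T : R) (u : R -> R -> R[i]) : @pdistr R := fun k =>
  cintegral `[0, T] (fun tau => opSL alpha (T - tau) (N (u tau)) k).

(* The existence part makes S_D(T) u_0 meaningful; the bound is imposed along
   every solution issued from u_0, uniqueness not being assumed. *)
Definition duhamel_estimate (p q s c eta : R) alpha (T : R) : Prop :=
  forall u0 : R -> R[i], sobolev0 sigma u0 -> valued_in K u0 ->
    (fun_hnorm sigma u0 <= eta%:E)%E ->
    (exists u, solution_on alpha 0 T u /\ ae_eq_fun (u 0) u0) /\
    (forall u, solution_on alpha 0 T u -> ae_eq_fun (u 0) u0 ->
      (hnorm (s + p) (opSD alpha T u) <=
       c%:E * fun_hnorm s u0 * fun_hnorm sigma u0 `^ q)%E).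

Definition nontrivial (u : R -> R -> R[i]) : Prop :=
  exists t, ~ ae_eq_fun (u t) (cst 0).

Definition mean_zero (u : R -> R -> R[i]) : Prop :=
  forall t, total_mean (u t) = 0.

Definition inf_norm (T : R) (u : R -> R -> R[i]) : \bar R :=
  ereal_inf [set fun_hnorm sigma (u t) | t in `[0, T]].

End Nonlinear.

Definition trivial_kernel alpha (T : R) : Prop :=
  forall f, sobolev0 0 f ->
    (forall k, fourier f k - opSL alpha T (fourier f) k = 0) ->
    ae_eq_fun f (cst 0).

(* W is admissible as W_{p,delta}. W is only required to be measurable for the
   completed (Lebesgue) sigma-algebra. Since x^-1 = 0 at x = 0, the bound alone
   would not exclude resonances; the trivial kernel condition does. *)
Definition period_set Z (T1 T2 p delta : R) (W : set R) : Prop :=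
  [/\ W `<=` `[T1, T2],
      (completed_algebra_gen (@lebesgue_measure R)).-sigma.-measurable W,
      ((T2 - T1 - delta)%:E < @completed_lebesgue_measure R W)%E,
      forall alpha T, Z alpha -> W T -> trivial_kernel alpha T &
      exists2 c1 : R, 0 < c1 &
        forall alpha (k : int) T, Z alpha -> k != 0 -> W T ->
          (cabs (1 - symbolSL alpha T k))^-1 < c1 * `|k%:~R| `^ p].

Definition union_period_set (T1 T2 : R) (W : R -> set R) : set R :=
  \bigcup_(n in [set n : nat | (2 <= n)%N]) W ((T2 - T1) / n%:R).

End EvolutionEquation.

(* Main.v *)
(* By Duhamel's formula a solution with u(t+T) = u(t) satisfies, mode by mode,
   (1 - e^{T A(k)}) u_k(t) = S_D(T)u(t)_k; the small divisor bound then gives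
   |u(t)|_{H^s} <= c1 c |u(t)|_{H^s} |u(t)|_{H^sigma}^q as soon as
   |u(t)|_{H^sigma} <= eta. If u(t) is nonzero, dividing by |u(t)|_{H^s} bounds
   |u(t)|_{H^sigma} from below by (c1 c)^{-1/q}.
   Uniqueness for the initial value problem is not assumed, so u(t) = 0 must be
   excluded differently. By the Duhamel estimate with any period a in W, the
   closed set of times where u vanishes is stable under translation by a, and it
   is T-periodic. Since W has positive measure, a can be chosen with a/T
   irrational; the vanishing times are then dense, and u is trivial. *)
Require Import Defs.
From mathcomp Require Import all_boot all_order all_algebra.
From mathcomp Require Import all_classical all_reals all_analysis.
From mathcomp Require Import measurable_realfun complex ring lra.

Set Implicit Arguments.
Unset Strict Implicit.
Unset Printing Implicit Defensive.
Import Order.TTheory GRing.Theory Num.Theory.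
Import numFieldNormedType.Exports.

Local Open Scope classical_set_scope.
Local Open Scope ring_scope.

(** * Density of the set generated by two incommensurable translations *)

Section Density.
Context {R : realType}.
Implicit Types (P : set R) (a d T e : R).

(* Pigeonhole on the fractional parts of [j * a / T]. *)
Lemma small_period a T e : 0 < T -> 0 < e -> ~ rational (a / T) ->
  exists (n : nat) (l : int),
    let d := n%:R * a + l%:~R * T in d != 0 /\ `|d| < e.
Proof.
move=> T0 e0 irr.
pose b := a / T.
have abT : a = b * T by rewrite /b mulfVK ?gt_eqF.
rewrite -/b in irr; clearbody b.
(* The unit interval is cut into [K] cells of width [1 / K], with [K] large enough that [T / K < e];
   [f] sends [i] to the cell of the fractional part of [i * b]. *)
pose K := (Num.truncn (T / e)).+1.
have KT : T / K%:R < e.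
  have : T / e < K%:R by exact: truncnS_gt.
  by rewrite ltr_pdivrMr// => H; rewrite ltr_pdivrMr ?ltr0n// mulrC.
pose frac (x : R) := x - (Num.floor x)%:~R.
have frac_ge0 x : 0 <= frac x by rewrite subr_ge0 floor_le_tmp.
have frac_lt1 x : frac x < 1.
  rewrite ltrBlDl; have := floorD1_gt x.
  by rewrite intrD.
pose f (i : 'I_K.+1) : 'I_K := inord (Num.truncn (K%:R * frac (i%:R * b))).
have fE i : f i = Num.truncn (K%:R * frac (i%:R * b)) :> nat.
  rewrite inordK// truncn_lt_nat// ?mulr_ge0//.
  by rewrite -[ltRHS]mulr1 ltr_pM2l// ltr0n.
have /injectivePn[i [j ij fij]] : ~~ injectiveb f.
  apply/negP => /injectiveP /leq_card.
  by rewrite !card_ord ltnn.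
wlog lt_ij : i j ij fij / (i < j)%N.
  move=> wl; move: (ij); rewrite neq_ltn => /orP[|] h; first exact: (wl i j).
  by apply: (wl j i) => //; rewrite eq_sym.
have close : `|K%:R * frac (j%:R * b) - K%:R * frac (i%:R * b)| < 1.
  have := congr1 (@nat_of_ord _) fij; rewrite !fE => trE.
  have h x : 0 <= K%:R * frac x by rewrite mulr_ge0.
  have /andP[i1 i2] := truncn_itv (h (i%:R * b)).
  have /andP[j1 j2] := truncn_itv (h (j%:R * b)).
  rewrite trE in i1 i2; move: i1 i2 j1 j2; rewrite -![_.+1%:R]natr1.
  move: (_ * frac (i%:R * b)) (_ * frac (j%:R * b)) => x y.
  rewrite ltr_norml; lra.
(* Subtracting the integer parts leaves [T] times a difference of two fractional parts from the same
   cell. *)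
exists (j - i)%N, (Num.floor (i%:R * b) - Num.floor (j%:R * b)).
set d := _ + _.
have dE : d = (frac (j%:R * b) - frac (i%:R * b)) * T.
  rewrite /d /frac natrB; last exact: ltnW.
  rewrite intrB abT.
  by move: (Num.floor (i%:R * b)) (Num.floor (j%:R * b)) => fi fj; ring.
split.
  (* If [d] were zero, [b] would be the quotient of a difference of floors by [j - i]. *)
  apply/eqP => d0; apply: irr.
  pose l := Num.floor (j%:R * b) - Num.floor (i%:R * b).
  exists (l%:~R / (j - i)%:R) => //.
  rewrite rmorphM/= fmorphV/= ratr_int ratr_nat.
  have nz : (j - i)%:R != 0 :> R by rewrite pnatr_eq0 subn_eq0 -ltnNge.
  apply: (mulIf nz); rewrite mulfVK//.
  apply: (mulIf (lt0r_neq0 T0)); apply/eqP; rewrite eq_sym -subr_eq0 -d0 /d /l.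
  by apply/eqP; rewrite !intrB abT; ring.
apply: le_lt_trans KT; rewrite dE normrM (gtr0_norm T0).
rewrite ler_pdivlMr ?ltr0n//.
have K0 : 0 < K%:R :> R by rewrite ltr0n.
rewrite -mulrBr normrM gtr0_norm// in close.
rewrite mulrAC -[leRHS]mul1r ler_pM2r//.
by rewrite mulrC ltW.
Qed.

(** [P] is stable under a nonzero translation [d] shorter than any given [e], so walking by [d] from
    a point of [P] passes within [e] of any [x]; closedness concludes. Translation by [a] is only
    available forwards, so the sign of [d] is not controlled; the two-sided invariance under [T]
    makes up for this. *)
Lemma incommensurable_periods P a T :
  0 < T -> ~ rational (a / T) -> closed P -> P !=set0 ->
  (forall x, P x -> P (x + a)) ->
  (forall x, P x -> P (x + T)) -> (forall x, P x -> P (x - T)) ->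
  P = setT.
Proof.
move=> T0 irr cP [t0 Pt0] Pa PT PNT.
have Pan x n : P x -> P (x + n%:R * a).
  elim: n => [|n IH] Px; first by rewrite mul0r addr0.
  by rewrite -natr1 mulrDl mul1r addrA; apply/Pa/IH.
have PTn x n : P x -> P (x + n%:R * T).
  elim: n => [|n IH] Px; first by rewrite mul0r addr0.
  by rewrite -natr1 mulrDl mul1r addrA; apply/PT/IH.
have PNTn x n : P x -> P (x - n%:R * T).
  elim: n => [|n IH] Px; first by rewrite mul0r subr0.
  by rewrite -natr1 mulrDl mul1r opprD addrA; apply/PNT/IH.
have Pl x (l : int) : P x -> P (x + l%:~R * T).
  move=> Px; case: l => n; first exact: PTn.
  by rewrite NegzE mulrNz mulNr; apply: PNTn.
apply/seteqP; split => // x _; apply: cP => B /nbhs_ballP[e /= e0 eB].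
have [n [l /= [d0 de]]] := small_period T0 e0 irr.
set d := _ + _ in d0 de.
have Pd y m : P y -> P (y + m%:R * d).
  elim: m => [|m IH] Py; first by rewrite mul0r addr0.
  rewrite -natr1 mulrDl mul1r addrA /d [_ + _ + (_ + _)]addrA.
  exact/Pl/Pan/IH.
(* The starting point is moved by a multiple of [T] to the side of [x] from which [d] points towards
   [x]. *)
have [y0 Py0 y0x] : exists2 y0, P y0 & 0 <= (x - y0) / d.
  pose m := (Num.truncn (`|x - t0| / T)).+1.
  have mT : `|x - t0| < m%:R * T by rewrite -ltr_pdivrMr// truncnS_gt.
  move: mT; rewrite ltr_norml => /andP[m1 m2].
  move: d0; rewrite neq_lt => /orP[d_lt0|d_gt0].
    exists (t0 + m%:R * T); first exact: PTn.
    by rewrite ler_ndivlMr// mul0r; lra.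
  exists (t0 - m%:R * T); first exact: PNTn.
  by rewrite divr_ge0// ?ltW//; lra.
(* Rounding down leaves a remainder in [0, 1) times [d]. *)
pose k := Num.truncn ((x - y0) / d).
exists (y0 + k%:R * d); split; first exact: Pd.
apply: eB; rewrite /ball/=; apply: le_lt_trans de.
have -> : x - (y0 + k%:R * d) = ((x - y0) / d - k%:R) * d.
  by rewrite mulrBl mulfVK//; ring.
rewrite normrM -[leRHS]mul1r ler_wpM2r//.
have /andP[] := truncn_itv y0x; rewrite -/k -natr1 ler_norml => k1 k2; lra.
Qed.

(** The rational multiples of [T] are countable, hence null, and cannot exhaust a set of positive
    measure. *)
Lemma irrational_scaled_exists (W : set R) T : 0 < T ->
  (0 < @completed_lebesgue_measure R W)%E ->
  exists2 a, W a & ~ rational (a / T).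
Proof.
move=> T0 W0; apply: contrapT => noa.
have : (@completed_lebesgue_measure R W = 0)%E.
  apply: countable_lebesgue_measure0.
  apply: (@sub_countable _ _ _ ((fun q : rat => ratr q * T) @` setT)).
    apply: subset_card_le => a Wa.
    have [q _ qa] : rational (a / T).
      by apply: contrapT => ?; apply: noa; exists a.
    by exists q => //; rewrite qa mulfVK ?gt_eqF.
  by apply: card_le_trans (card_image_le _ _) _; exact: countableP.
by move=> E; rewrite E ltxx in W0.
Qed.

End Density.

(** * Variation of constants, Fourier integrands and the complex modulus *)

Section ComplexFunctions.
Context {R : realType}.
Implicit Types (f g : R -> R) (z : R[i]).

Lemma Rintegral_is_derive (F f : R -> R) a b : a < b ->
  (forall x, is_derive x (1 : R) F (f x)) ->
  {within `[a, b], continuous f} ->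
  (\int[lebesgue_measure]_(x in `[a, b]) f x) = F b - F a.
Proof.
move=> ab dF cf.
have cF x : {for x, continuous F}.
  by apply/differentiable_continuous/derivable1_diffP; case: (dF x).
rewrite /Rintegral (continuous_FTC2 ab cf (F := F)) //.
- split; first by move=> x _; case: (dF x).
  + exact/cvg_at_right_filter/cF.
  + exact/cvg_at_left_filter/cF.
- by move=> x _; rewrite derive1E; apply: derive_val.
Qed.

Lemma cexp_Im (y : R) : cexp (0 +i* y)%C = (cos y +i* sin y)%C.
Proof. by rewrite /cexp /= expR0 !mul1r. Qed.

Lemma is_derive_linear_comp (F : R -> R) (F' : R) (a b x : R) :
  is_derive (a * x + b) (1 : R) F F' ->
  is_derive x (1 : R) (fun y => F (a * y + b)) (a * F').
Proof.
move=> dF; rewrite mulrC.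
apply: (@is_derive1_comp _ F (fun y => a * y + b) x F' a) => //.
have : is_derive x (1 : R) (fun y : R => a * y + b) (a *: 1 + 0).
  by apply: is_deriveD; apply: is_deriveZ.
by rewrite addr0 /GRing.scale /= mulr1.
Qed.

Lemma cintegral_eq (D : set R) (f g : R -> R[i]) :
  {in D, f =1 g} -> cintegral D f = cintegral D g.
Proof.
move=> fg; rewrite /cintegral.
by congr (_ +i* _)%C; apply: eq_Rintegral => x xD; rewrite fg.
Qed.

(** Integrating factor: the derivative of e^(i om (T - t)) w(t) is e^(i om (T - t)) m(t), and the
    fundamental theorem of calculus is applied to the real and imaginary parts separately. *)
Lemma variation_of_constants (w m : R -> R[i]) (om T : R) : 0 < T ->
  (forall t, is_cderive w t ((0 +i* om)%C * w t + m t)) ->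
  ccontinuous_on `[0, T] m ->
  w T = cexp (T%:C%C * (0 +i* om)%C) * w 0 +
    cintegral `[0, T] (fun tau => cexp ((T - tau)%:C%C * (0 +i* om)%C) * m tau).
Proof.
move=> T0 dw [cmr cmi].
pose wr t := complex.Re (w t); pose wi t := complex.Im (w t).
pose mr t := complex.Re (m t); pose mi t := complex.Im (m t).
(* Real and imaginary parts of the integrating factor, with the phase in the affine form expected by
   [is_derive_linear_comp]. *)
pose C t := cos (- om * t + om * T); pose S t := sin (- om * t + om * T).
have eE (x : R) :
    cexp (x%:C%C * (0 +i* om)%C) = (cos (x * om) +i* sin (x * om))%C.
  rewrite -cexp_Im; congr cexp; apply/eqP; rewrite eq_complex /=.
  by apply/andP; split; apply/eqP; ring.
have dwr t : is_derive t (1 : R) wr (- om * wi t + mr t).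
  have [h _] := dw t; move: h; rewrite /wi /mr.
  by case: (w t) (m t) => a b [c d] /=; rewrite mul0r sub0r mulNr.
have dwi t : is_derive t (1 : R) wi (om * wr t + mi t).
  have [_ h] := dw t; move: h; rewrite /wr /mi.
  by case: (w t) (m t) => a b [c d] /=; rewrite mul0r add0r.
have dC t : is_derive t (1 : R) C (- om * - S t).
  exact: is_derive_linear_comp.
have dS t : is_derive t (1 : R) S (- om * C t).
  exact: is_derive_linear_comp.
have cC : continuous C.
  by move=> t; apply/differentiable_continuous/derivable1_diffP; case: (dC t).
have cS : continuous S.
  by move=> t; apply/differentiable_continuous/derivable1_diffP; case: (dS t).
have IE (x : R) :
    cexp ((T - x)%:C%C * (0 +i* om)%C) * m x =
    ((C x * mr x - S x * mi x) +i* (C x * mi x + S x * mr x))%C.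
  rewrite eE /C /S /mr /mi.
  by rewrite (_ : (T - x) * om = - om * x + om * T); [case: (m x)|ring].
rewrite (cintegral_eq (fun x _ => IE x)).
rewrite /cintegral /=.
have dFr t : is_derive t (1 : R) (fun t => C t * wr t - S t * wi t)
    (C t * mr t - S t * mi t).
  have dF := is_deriveB (is_deriveM (dC t) (dwr t)) (is_deriveM (dS t) (dwi t)).
  by apply: (is_derive_eq dF); rewrite /GRing.scale /=; ring.
have dFi t : is_derive t (1 : R) (fun t => C t * wi t + S t * wr t)
    (C t * mi t + S t * mr t).
  have dF := is_deriveD (is_deriveM (dC t) (dwi t)) (is_deriveM (dS t) (dwr t)).
  by apply: (is_derive_eq dF); rewrite /GRing.scale /=; ring.
have cFr : {within `[0, T], continuous (fun x => C x * mr x - S x * mi x)}.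
  move=> x; apply: cvgB; apply: cvgM;
    by [exact: continuous_subspaceT | exact: cmr | exact: cmi].
have cFi : {within `[0, T], continuous (fun x => C x * mi x + S x * mr x)}.
  move=> x; apply: cvgD; apply: cvgM;
    by [exact: continuous_subspaceT | exact: cmr | exact: cmi].
rewrite (Rintegral_is_derive T0 dFr cFr) (Rintegral_is_derive T0 dFi cFi).
rewrite eE /C /S /wr /wi mulr0 add0r mulNr addrC addNr.
rewrite cos0 sin0 (mulrC T).
case: (w T) (w 0) => a b [c d] /=.
by apply/eqP; rewrite eq_complex /=; apply/andP; split; apply/eqP; ring.
Qed.

Lemma fourier_integrandE (f : R -> R[i]) (k : int) x :
  f x * cexp (0 -i* (k%:~R * x))%C =
  ((complex.Re (f x) * cos (k%:~R * x) + complex.Im (f x) * sin (k%:~R * x)) +i*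
   (complex.Im (f x) * cos (k%:~R * x) - complex.Re (f x) * sin (k%:~R * x)))%C.
Proof.
rewrite cexp_Im cosN sinN; case: (f x) => a b /=.
by apply/eqP; rewrite eq_complex /=; apply/andP; split; apply/eqP; ring.
Qed.

Lemma measurable_trig (k : int) :
  measurable_fun setT (fun x : R => cos (k%:~R * x)) /\
  measurable_fun setT (fun x : R => sin (k%:~R * x)).
Proof.
have mk : measurable_fun setT (fun x : R => k%:~R * x).
  exact: measurable_funM.
split.
- apply: (measurableT_comp (f := cos)); last exact: mk.
  by apply: continuous_measurable_fun; exact: continuous_cos.
- apply: (measurableT_comp (f := sin)); last exact: mk.
  by apply: continuous_measurable_fun; exact: continuous_sin.
Qed.

(** Time periodicity holds only up to null sets in x; this turns it into exact equality of
    coefficients. The measurability in [periodicL2] is what lets the integrals ignore the null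
    set. *)
Lemma ae_eq_fourier (f g : R -> R[i]) :
  periodicL2 f -> periodicL2 g -> ae_eq_fun f g -> fourier f = fourier g.
Proof.
move=> [_ mfr mfi _] [_ mgr mgi _] [A [mA A0 sA]]; apply/funext => k.
have [mcos msin] := measurable_trig k.
have mRe (h : R -> R[i]) : measurable_fun setT (fun x => complex.Re (h x)) ->
    measurable_fun setT (fun x => complex.Im (h x)) ->
    measurable_fun `[0, 2 * pi]
      (fun x => complex.Re (h x * cexp (0 -i* (k%:~R * x))%C)).
  move=> mr mi; apply: measurable_funTS.
  under eq_fun do rewrite fourier_integrandE /=.
  by apply: measurable_funD; apply: measurable_funM.
have mIm (h : R -> R[i]) : measurable_fun setT (fun x => complex.Re (h x)) ->
    measurable_fun setT (fun x => complex.Im (h x)) ->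
    measurable_fun `[0, 2 * pi]
      (fun x => complex.Im (h x * cexp (0 -i* (k%:~R * x))%C)).
  move=> mr mi; apply: measurable_funTS.
  under eq_fun do rewrite fourier_integrandE /=.
  by apply: measurable_funB; apply: measurable_funM.
rewrite /fourier; congr (_ * _).
rewrite /cintegral; congr (_ +i* _)%C; rewrite /Rintegral; congr fine;
  apply: ae_eq_integral => //; try (apply/measurable_EFinP).
- exact: mRe.
- exact: mRe.
- by exists A; split => // x /= H; apply: sA => /= E; apply: H => _; rewrite E.
- exact: mIm.
- exact: mIm.
- by exists A; split => // x /= H; apply: sA => /= E; apply: H => _; rewrite E.
Qed.

Lemma cabs_ge0 z : 0 <= cabs z. Proof. exact: sqrtr_ge0. Qed.

Lemma cabs0 : cabs (0 : R[i]) = 0.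
Proof. by rewrite /cabs expr0n addr0 sqrtr0. Qed.

Lemma cabsM z1 z2 : cabs (z1 * z2) = cabs z1 * cabs z2.
Proof.
rewrite /cabs -sqrtrM ?addr_ge0 ?sqr_ge0//; congr Num.sqrt.
by case: z1 z2 => a b [c d] /=; ring.
Qed.

Lemma cabs_eq0 z : (cabs z == 0) = (z == 0).
Proof.
rewrite sqrtr_eq0 eq_complex le_eqVlt ltNge addr_ge0 ?sqr_ge0//= orbF.
by rewrite paddr_eq0 ?sqr_ge0// !sqrf_eq0.
Qed.

End ComplexFunctions.

(** * The exponentials e^(ikx), test functions for the trivial kernel condition *)

Section PureModes.
Context {R : realType}.

Definition pure_mode (k : int) (x : R) : R[i] := cexp (0 +i* (k%:~R * x))%C.

Lemma pure_modeE k x :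
  pure_mode k x = (cos (k%:~R * x) +i* sin (k%:~R * x))%C.
Proof. exact: cexp_Im. Qed.

Lemma cabs_pure_mode k x : cabs (pure_mode k x) = 1.
Proof. by rewrite pure_modeE /cabs /= cos2Dsin2 sqrtr1. Qed.

Lemma trig_int_period (k : int) (x : R) :
  cos (x + k%:~R * (2 * pi)) = cos x /\ sin (x + k%:~R * (2 * pi)) = sin x.
Proof.
have E : (2 * pi : R) = pi *+ 2 by rewrite mulr_natl.
have pn (n : nat) (y : R) :
    cos (y + n%:R * (2 * pi)) = cos y /\ sin (y + n%:R * (2 * pi)) = sin y.
  elim: n => [|n [IHc IHs]]; first by rewrite mul0r addr0.
  by rewrite -[n.+1%:R]natr1 mulrDl mul1r addrA E cosD2pi sinD2pi -E.
case: k => n; first exact: pn.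
rewrite NegzE mulrNz mulNr.
by have [<- <-] := pn n.+1 (x - n.+1%:R * (2 * pi)); rewrite subrK.
Qed.

Lemma cintegral_pure_mode k : k != 0 ->
  cintegral `[0, 2 * pi] (pure_mode k) = 0.
Proof.
move=> k0.
have k0R : (k%:~R : R) != 0 by rewrite intr_eq0.
have pi2 : 0 < 2 * pi :> R by rewrite mulr_gt0// pi_gt0.
(* Explicit primitives of the two parts, both [2 * pi]-periodic; the [+ 0] gives them the affine
   shape of [is_derive_linear_comp]. *)
have dS x : is_derive x (1 : R)
    (fun y => sin (k%:~R * y + 0) / k%:~R) (cos (k%:~R * x)).
  have dF := is_derive_linear_comp (is_derive_sin (k%:~R * x + 0)).
  have dG := is_deriveZ (k%:~R^-1 : R) dF.
  rewrite (_ : (fun y => _) =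
      k%:~R^-1 \*: (fun y => sin (k%:~R * y + 0))); last first.
    by apply/funext => y /=; rewrite /GRing.scale/= mulrC.
  by apply: (is_derive_eq dG); rewrite /GRing.scale /= mulKf// addr0.
have dC x : is_derive x (1 : R)
    (fun y => - cos (k%:~R * y + 0) / k%:~R) (sin (k%:~R * x)).
  have dF := is_derive_linear_comp (is_derive_cos (k%:~R * x + 0)).
  have dG := is_deriveZ (- k%:~R^-1 : R) dF.
  rewrite (_ : (fun y => _) =
      (- k%:~R^-1) \*: (fun y => cos (k%:~R * y + 0))); last first.
    by apply/funext => y /=; rewrite /GRing.scale/= mulrC mulrN mulNr.
  by apply: (is_derive_eq dG); rewrite /GRing.scale /= addr0; field.
have cont (f : R -> R) : continuous f ->
    {within `[0, 2 * pi], continuous (fun x => f (k%:~R * x))}.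
  move=> cf; apply: continuous_subspaceT => x.
  apply: (@cvg_comp _ _ _ (fun y : R => k%:~R * y) f _ (nbhs (k%:~R * x)));
    last exact: cf.
  by apply: cvgM; [exact: cvg_cst|exact: cvg_id].
rewrite (cintegral_eq (fun x _ => pure_modeE k x)).
rewrite /cintegral /=.
rewrite (Rintegral_is_derive pi2 dS (cont _ (@continuous_cos R))).
rewrite (Rintegral_is_derive pi2 dC (cont _ (@continuous_sin R))).
have [c2 s2] := trig_int_period k 0.
rewrite !addr0 add0r in c2 s2 *.
by rewrite c2 s2 mulr0 !subrr.
Qed.

(** Orthogonality: e^(ikx) e^(-ijx) is the pure mode [k - j], whose integral over a period is
    zero. *)
Lemma fourier_pure_mode (k j : int) : j != k -> fourier (pure_mode k) j = 0.
Proof.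
move=> jk; rewrite /fourier.
rewrite (cintegral_eq (g := pure_mode (k - j))); last first.
  move=> x _; rewrite pure_modeE cexp_Im pure_modeE.
  rewrite intrB mulrBl cosB sinB cosN sinN.
  by apply/eqP; rewrite eq_complex /=; apply/andP; split; apply/eqP; ring.
by rewrite cintegral_pure_mode ?mulr0// subr_eq0 eq_sym.
Qed.

Lemma periodicL2_pure_mode k : periodicL2 (pure_mode k).
Proof.
have [mcos msin] := @measurable_trig R k.
split.
- move=> x; rewrite !pure_modeE mulrDr.
  by have [-> ->] := trig_int_period k (k%:~R * x).
- by under eq_fun do rewrite pure_modeE /=.
- by under eq_fun do rewrite pure_modeE /=.
- rewrite (_ : (fun x => _) = EFin \o (cst 1 : R -> R)); last first.
    by apply/funext => x; rewrite cabs_pure_mode expr1n.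
  apply: continuous_compact_integrable; first exact: segment_compact.
  by apply: continuous_subspaceT; exact: cst_continuous.
Qed.

(** The modulus is 1 everywhere, so the exceptional set would contain [0, 1]. *)
Lemma not_ae_eq_pure_mode k : ~ ae_eq_fun (pure_mode k) (cst 0).
Proof.
move=> [A [mA A0 sA]].
have : (lebesgue_measure (`[0%R, 1%R]%classic : set R) = 0)%E.
  apply/eqP; rewrite eq_le measure_ge0 andbT -A0 le_measure ?inE//.
  move=> x _; apply: sA => /= E.
  have := cabs_pure_mode k x; rewrite E cabs0 => /eqP.
  by rewrite eq_sym oner_eq0.
rewrite lebesgue_measure_itv /= lte_fin ltr01 oppr0 adde0 => /eqP.
by rewrite eqe oner_eq0.
Qed.

End PureModes.

(** * Vanishing, finiteness and comparison of Sobolev norms *)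

Section SobolevNorms.
Context {R : realType}.
Implicit Types (s : R) (a b : @pdistr R) (k : int).

Let term s a k : R := (1 + k%:~R ^+ 2) `^ s * cabs (a k) ^+ 2.

Let term_ge0 s a k : 0 <= term s a k.
Proof. by rewrite mulr_ge0 ?powR_ge0 ?sqr_ge0. Qed.

Let esum_term_ge0 s a : (0 <= \esum_(k in [set: int]) (term s a k)%:E)%E.
Proof. by apply: esum_ge0 => k _; rewrite lee_fin term_ge0. Qed.

Lemma hnorm_ge0 s a : (0 <= hnorm s a)%E.
Proof. exact: poweR_ge0. Qed.

(** All weights are positive whatever the order [s], so vanishing passes between norms of different
    orders. *)
Lemma hnorm0P s a : hnorm s a = 0%E <-> forall k, a k = 0.
Proof.
split=> [h k|h].
  have E0 : (\esum_(k in [set: int]) (term s a k)%:E = 0)%E.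
    by apply: poweR_eq0_eq0 h; exact: esum_term_ge0.
  have : ((term s a k)%:E <= 0)%E.
    rewrite -E0; apply: esum_ge; exists [set k]; first by split.
    by rewrite fsbig_set1.
  rewrite lee_fin => le0.
  have /eqP : term s a k = 0 by apply/eqP; rewrite eq_le le0 term_ge0.
  rewrite /term mulf_eq0 => /orP[|].
    rewrite gt_eqF// powR_gt0// ltr_pwDl ?sqr_ge0//.
  by rewrite sqrf_eq0 cabs_eq0 => /eqP.
rewrite /hnorm esum1 ?poweR0r ?invr_neq0// => k _.
by rewrite h cabs0 expr0n mulr0.
Qed.

Lemma hnorm_finite_support s a k : (forall j, j != k -> a j = 0) ->
  (hnorm s a < +oo)%E.
Proof.
move=> a0; apply: poweR_lty.
rewrite (_ : (\esum_(j in _) _)%E = (\esum_(j in [set k]) (term s a j)%:E)%E).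
  by rewrite esum_set1 ?ltry// lee_fin term_ge0.
rewrite [RHS]esum_mkcond; apply: eq_esum => j _.
case: ifPn => //; rewrite notin_setE /= => jk.
by rewrite a0 ?cabs0 ?expr0n ?mulr0//; apply/eqP.
Qed.

Lemma le_hnorm s s' a b (C : R) : 0 <= C ->
  (forall k, (1 + k%:~R ^+ 2) `^ s * cabs (a k) ^+ 2 <=
     C ^+ 2 * ((1 + k%:~R ^+ 2) `^ s' * cabs (b k) ^+ 2)) ->
  (hnorm s a <= C%:E * hnorm s' b)%E.
Proof.
move=> C0 h.
(* The constant goes under the square root, which reduces the claim to the sums, and then to their
   finite partial sums. *)
have -> : C%:E = ((C ^+ 2)%:E `^ 2^-1)%E.
  by rewrite poweR_EFin powR12_sqrt ?sqr_ge0// sqrtr_sqr ger0_norm.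
rewrite -poweRM ?lee_fin ?sqr_ge0//; last exact: esum_term_ge0.
apply: gt0_ler_poweR => //.
- by rewrite in_itv/= leey andbT; exact: esum_term_ge0.
- rewrite in_itv/= leey andbT; apply: mule_ge0; last exact: esum_term_ge0.
  by rewrite lee_fin sqr_ge0.
apply: ge_ereal_sup => _ [X [finX _] <-].
apply: (@le_trans _ _ (\sum_(k \in X) ((C ^+ 2)%:E * (term s' b k)%:E))%E).
  by apply: lee_fsum => // k _; rewrite -EFinM lee_fin; exact: h.
rewrite -ge0_mule_fsumr; last by move=> k; rewrite lee_fin term_ge0.
apply: lee_wpmul2l; first by rewrite lee_fin sqr_ge0.
by apply: esum_ge; exists X.
Qed.

End SobolevNorms.

(** * Solutions defined for all times: Duhamel's formula and vanishing times *)

Section PeriodicOrbits.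
Context {R : realType} (K : scalars) (M : nat) (kpow : 'I_M -> int -> R).
Variables (sigma : R) (N : (R -> R[i]) -> @pdistr R) (alpha : 'I_M -> R).
Implicit Types (u : R -> R -> R[i]) (t T : R) (k : int).

(** At a resonance, e^(ikx) would be a nonzero mean-zero element of the kernel. *)
Lemma trivial_kernel_nonresonant T k :
  trivial_kernel kpow alpha T -> k != 0 -> 1 - symbolSL kpow alpha T k != 0.
Proof.
move=> ker k0; apply/eqP => res; apply: (@not_ae_eq_pure_mode R k).
apply: ker.
  split; last exact: cintegral_pure_mode.
  split; first exact: periodicL2_pure_mode.
  by apply: (@hnorm_finite_support _ _ _ k) => j; exact: fourier_pure_mode.
move=> j; rewrite /opSL.
have [->|jk] := eqVneq j k; last by rewrite fourier_pure_mode// mulr0 subrr.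
by rewrite -[X in X - _]mul1r -mulrBl res mul0r.
Qed.

Lemma fourier_mean (f : R -> R[i]) :
  fourier f 0 = ((2 * pi)^-1)%:C%C * total_mean f.
Proof.
rewrite /fourier /total_mean; congr (_ * _); apply: cintegral_eq => x _.
by rewrite mul0r cexp_Im oppr0 cos0 sin0 -[RHS]mulr1.
Qed.

(** The part of [time_periodic_solution] that does not mention the period. *)
Definition global_solution u :=
  forall a b, a < b -> solution_on kpow K sigma N alpha a b u.

Lemma global_solution_sobolev u t : global_solution u ->
  sobolev sigma (u t) /\ valued_in K (u t).
Proof.
move=> us; have tt1 : t < t + 1 by rewrite ltrDl.
by have [h _ _ _] := us _ _ tt1; apply: h; rewrite in_itv/= lexx ltW.
Qed.

Lemma global_solution_derive u t k : global_solution u ->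
  is_cderive (fun t' => fourier (u t') k) t
    (opA kpow alpha (fourier (u t)) k + N (u t) k).
Proof.
move=> us; have tt1 : t - 1 < t + 1 by lra.
by have [_ _ _ h] := us _ _ tt1; apply: h; rewrite in_itv/=;
  apply/andP; split; lra.
Qed.

Lemma global_solution_continuousN u k : global_solution u ->
  continuous (fun t => complex.Re (N (u t) k)) /\
  continuous (fun t => complex.Im (N (u t) k)).
Proof.
move=> us; split=> t; have tt1 : t - 1 < t + 1 by lra.
  have [_ _ h _] := us _ _ tt1.
  have [/(continuous_within_itvP _ tt1)[c _ _] _] := h k.
  by apply: c; rewrite in_itv/=; apply/andP; split; lra.
have [_ _ h _] := us _ _ tt1.
have [_ /(continuous_within_itvP _ tt1)[c _ _]] := h k.
by apply: c; rewrite in_itv/=; apply/andP; split; lra.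
Qed.

Lemma is_derive_shift (F : R -> R) (F' t0 t : R) :
  is_derive (t0 + t) (1 : R) F F' ->
  is_derive t (1 : R) (fun t' => F (t0 + t')) F'.
Proof.
rewrite -[t in t0 + t]mul1r addrC => /is_derive_linear_comp.
by rewrite mul1r; under eq_fun do rewrite mul1r addrC.
Qed.

Lemma continuous_shift (F : R -> R) t0 :
  continuous F -> continuous (fun t => F (t0 + t)).
Proof.
move=> cF t; apply: (@cvg_comp _ _ _ (fun y : R => t0 + y) F _ (nbhs (t0 + t))).
  by apply: cvgD; [exact: cvg_cst|exact: cvg_id].
exact: cF.
Qed.

(** The equation is autonomous. Every time on the orbit can thus serve as initial time, while
    [duhamel_estimate] and [opSD] start at time 0. *)
Lemma global_solution_shift u t0 : global_solution u ->
  global_solution (fun t => u (t0 + t)).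
Proof.
move=> us a b ab.
have ab' : t0 + a < t0 + b by rewrite ltrD2l.
have inshift t : t \in `[a, b] -> t0 + t \in `[t0 + a, t0 + b].
  by rewrite !in_itv/= !lerD2l.
split.
- by move=> t _; exact: global_solution_sobolev.
- move=> s0 s0ab; have [_ h _ _] := us _ _ ab'.
  apply: (@cvg_comp _ _ _ (fun t => t0 + t)
    (fun t => hnorm sigma (fourier (u t) \- fourier (u (t0 + s0)))) _
    (within `[t0 + a, t0 + b] (nbhs (t0 + s0)))); last exact/h/inshift.
  move=> U; rewrite /within /= => nU.
  have ct : (fun t => t0 + t) x @[x --> s0] --> t0 + s0.
    by apply: cvgD; [exact: cvg_cst|exact: cvg_id].
  have := ct _ nU; apply: (@filterS R (nbhs s0)).
  by move=> x /= h' xab; exact: (h' (inshift _ xab)).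
- move=> k; have [cr ci] := global_solution_continuousN k us.
  by split; apply: continuous_subspaceT;
    [exact: (continuous_shift cr)|exact: (continuous_shift ci)].
- move=> t k _; have [dr di] := global_solution_derive (t0 + t) k us.
  by split; exact: is_derive_shift.
Qed.

(** Each Fourier mode solves a scalar linear equation with imaginary coefficient and source
    [N (u t) k], so variation of constants applies to the shifted solution. *)
Lemma duhamel u t0 T k : global_solution u -> 0 < T ->
  fourier (u (t0 + T)) k =
  symbolSL kpow alpha T k * fourier (u t0) k +
  opSD kpow N alpha T (fun t => u (t0 + t)) k.
Proof.
move=> us T0; have vs := global_solution_shift t0 us.
have [_ _ cN _] := vs _ _ T0.
have := @variation_of_constants R (fun t => fourier (u (t0 + t)) k)
  (fun t => N (u (t0 + t)) k) _ T T0 _ (cN k).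
rewrite /= addr0; apply => t.
exact: (global_solution_derive t k vs).
Qed.

(** Vanishing is read on the coefficients, which depend continuously on time, unlike
    almost-everywhere equality to 0. *)
Definition vanishing_times u := [set t | forall k, fourier (u t) k = 0].

(** An intersection over [k] of zero sets of functions that are differentiable, hence continuous, in
    time. *)
Lemma closed_vanishing_times u :
  global_solution u -> closed (vanishing_times u).
Proof.
move=> us.
have -> : vanishing_times u = \bigcap_(k in [set: int])
    ((fun t => complex.Re (fourier (u t) k)) @^-1` [set 0] `&`
     (fun t => complex.Im (fourier (u t) k)) @^-1` [set 0]).
  apply/seteqP; split=> t h k.
    by split; [exact: (congr1 (@complex.Re R) (h k))
              |exact: (congr1 (@complex.Im R) (h k))].
  have [h1 h2] := h k I; apply/eqP; rewrite eq_complex; apply/andP.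
  by split; apply/eqP; [exact: h1|exact: h2].
apply: closed_bigI => k _; apply: closedI;
  (apply: closed_comp; last exact: closed_eq) => t _;
  apply/differentiable_continuous/derivable1_diffP;
  by have [[? _] [? _]] := global_solution_derive t k us.
Qed.

Section Estimate.
Variables (p q s c eta : R).
Hypothesis heta : 0 < eta.

(** The shifted orbit is one of the solutions issued from [u t], and the estimate bounds all of
    them. *)
Lemma estimate_along_orbit u t T :
  duhamel_estimate kpow K sigma N p q s c eta alpha T -> 0 < T ->
  global_solution u -> mean_zero u -> (fun_hnorm sigma (u t) <= eta%:E)%E ->
  (hnorm (s + p)%R (opSD kpow N alpha T (fun t' => u (t + t')%R)) <=
   c%:E * fun_hnorm s (u t) * fun_hnorm sigma (u t) `^ q)%E.
Proof.
move=> est T0 us um small.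
have [sob val] := global_solution_sobolev t us.
have [_] := est (u t) (conj sob (um t)) val small.
apply; first exact: global_solution_shift.
by rewrite addr0; apply: aeW.
Qed.

(** Zero data are small and make the right side of the estimate zero, so the Duhamel term vanishes;
    the linear flow maps zero to zero. This stands in for uniqueness of the zero solution. *)
Lemma vanishing_times_step u t T :
  duhamel_estimate kpow K sigma N p q s c eta alpha T -> 0 < T ->
  global_solution u -> mean_zero u ->
  vanishing_times u t -> vanishing_times u (t + T).
Proof.
move=> est T0 us um ut0.
have Z s' : fun_hnorm s' (u t) = 0%E by apply/hnorm0P.
have small : (fun_hnorm sigma (u t) <= eta%:E)%E by rewrite Z lee_fin ltW.
have := estimate_along_orbit est T0 us um small.
rewrite !Z mule0 mul0e => SD0.
have /hnorm0P SD :
    hnorm (s + p) (opSD kpow N alpha T (fun t' => u (t + t'))) = 0%E.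
  by apply/eqP; rewrite eq_le SD0 hnorm_ge0.
by move=> k; rewrite (duhamel t k us T0) ut0 mulr0 add0r SD.
Qed.

End Estimate.

End PeriodicOrbits.

(** * The lower bound for a fixed parameter vector and period *)

Section LowerBound.
Context {R : realType} (K : scalars) (M : nat) (kpow : 'I_M -> int -> R).
Variables (sigma : R) (N : (R -> R[i]) -> @pdistr R) (alpha : 'I_M -> R).
Variables (p q s c eta T : R).
Hypotheses (hp : 0 <= p) (hq : 0 < q) (hc : 0 < c) (heta : 0 < eta).
Hypotheses (s_sigma : s <= sigma) (T0 : 0 < T).
Hypothesis ker : trivial_kernel kpow alpha T.
Hypothesis estT : duhamel_estimate kpow K sigma N p q s c eta alpha T.

Lemma periodic_fourier u t : time_periodic_solution kpow K sigma N alpha T u ->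
  fourier (u (t + T)) = fourier (u t).
Proof.
move=> [us uT]; have sob t' := (global_solution_sobolev t' us).1.
apply: ae_eq_fourier; [exact: (sob (t + T)).1|exact: (sob t).1|exact: uT].
Qed.

(** The estimate is used at a time [a] incommensurable with the period [T] of [u]: one vanishing
    time would spread to all times. *)
Lemma nontrivial_periodic_nonvanishing u a t :
  duhamel_estimate kpow K sigma N p q s c eta alpha a -> 0 < a ->
  ~ rational (a / T) -> time_periodic_solution kpow K sigma N alpha T u ->
  mean_zero u -> nontrivial u -> ~ vanishing_times u t.
Proof.
move=> esta a0 irr uper um [t1 ut1] ut; have [us _] := uper; apply: ut1.
have vT : vanishing_times u = setT.
  apply: (incommensurable_periods T0 irr (closed_vanishing_times us)).
  - by exists t.
  - by move=> x; exact: (vanishing_times_step heta esta a0 us um).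
  - by move=> x ux k; rewrite periodic_fourier.
  - by move=> x ux k; rewrite -(periodic_fourier (x - T))// subrK.
have ut1 k : fourier (u t1) k = 0.
  by have : vanishing_times u t1 by [rewrite vT]; exact.
(* Uniqueness of Fourier coefficients is itself an instance of the trivial
   kernel condition. *)
apply: ker => [|k]; last by rewrite /opSL !ut1 mulr0 subrr.
split; last exact: um.
split; first exact: (global_solution_sobolev t1 us).1.1.
by apply: (@hnorm_finite_support _ _ _ 0) => j _.
Qed.

Variable c1 : R.
Hypothesis hc1 : 0 < c1.
Hypothesis small_divisors : forall k : int, k != 0 ->
  (cabs (1 - symbolSL kpow alpha T k))^-1 < c1 * `|k%:~R| `^ p.

(** Inverting [1 - symbolSL] mode by mode costs a factor [c1 * |k| ^ p], which the [p] extra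
    derivatives measured on [b] absorb. At [k = 0] there is no divisor bound, whence the assumption
    on [a 0]. *)
Lemma hnorm_le_duhamel (a b : @pdistr R) : a 0 = 0 ->
  (forall k, a k = symbolSL kpow alpha T k * a k + b k) ->
  (hnorm s a <= c1%:E * hnorm (s + p)%R b)%E.
Proof.
move=> a0 ab; apply: le_hnorm; first exact: ltW.
move=> k; have [->|k0] := eqVneq k 0.
  rewrite a0 cabs0 expr0n /= mulr0; apply: mulr_ge0; first exact: sqr_ge0.
  by apply: mulr_ge0; [exact: powR_ge0|exact: sqr_ge0].
have nz := trivial_kernel_nonresonant ker k0.
have bE : b k = (1 - symbolSL kpow alpha T k) * a k.
  by rewrite mulrBl mul1r {1}(ab k) addrC addKr.
have nz' : cabs (1 - symbolSL kpow alpha T k) != 0 by rewrite cabs_eq0.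
have aE : cabs (a k) = (cabs (1 - symbolSL kpow alpha T k))^-1 * cabs (b k).
  by rewrite bE cabsM mulKf.
have le1 : cabs (a k) <= c1 * `|k%:~R| `^ p * cabs (b k).
  by rewrite aE ler_wpM2r ?cabs_ge0// ltW// small_divisors.
(* The squared divisor loss is at most the ratio of the weights of orders [s + p] and [s]. *)
have kp : (`|k%:~R| `^ p) ^+ 2 <= (1 + k%:~R ^+ 2 : R) `^ p.
  rewrite -powR_mulrn ?powR_ge0// -powRrM mulrC powRrM powR_mulrn//.
  apply: ge0_ler_powR => //; rewrite ?nnegrE ?sqr_ge0 ?addr_ge0 ?sqr_ge0//.
  by rewrite real_normK ?num_real// lerDr.
have pos : (1 + k%:~R ^+ 2 : R) != 0 by rewrite gt_eqF// ltr_pwDl ?sqr_ge0.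
rewrite powRD; last by rewrite pos implybT.
apply: (@le_trans _ _
    ((1 + k%:~R ^+ 2) `^ s * (c1 * `|k%:~R| `^ p * cabs (b k)) ^+ 2)).
  rewrite ler_wpM2l ?powR_ge0// lerXn2r ?nnegrE ?cabs_ge0//.
  by rewrite !mulr_ge0 ?powR_ge0 ?cabs_ge0// ltW.
rewrite !exprMn.
have -> (x y z w : R) : x * (y * z * w) = y * x * w * z by ring.
have -> (x y z w : R) : x * (y * z * w) = x * y * w * z by ring.
apply: ler_wpM2l kp; apply: mulr_ge0; last exact: sqr_ge0.
by apply: mulr_ge0; [exact: powR_ge0|exact: sqr_ge0].
Qed.

(** The second entry is the root y of [c1 * c * y ^ q = 1]; the first keeps the data within reach of
    the estimate. *)
Definition norm_threshold := Num.min eta ((c1 * c)^-1 `^ q^-1).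

Lemma norm_threshold_gt0 : 0 < norm_threshold.
Proof. by rewrite lt_min heta powR_gt0// invr_gt0 mulr_gt0. Qed.

(** Let X and Y be the norms of [u t] of orders [s] and [sigma]. Below the threshold, periodicity
    and the estimate give X <= c1 c X Y^q < X, which is absurd for 0 < X < +oo. *)
Lemma nonvanishing_norm_ge u t :
  time_periodic_solution kpow K sigma N alpha T u -> mean_zero u ->
  ~ vanishing_times u t ->
  (norm_threshold%:E <= fun_hnorm sigma (u t))%E.
Proof.
move=> uper um nv; have [us _] := uper.
have [[_ fin] _] := global_solution_sobolev t us.
rewrite leNgt; apply/negP => small.
have small_eta : (fun_hnorm sigma (u t) <= eta%:E)%E.
  by apply: ltW; apply: lt_le_trans small _; rewrite lee_fin ge_min lexx.
have est := estimate_along_orbit estT T0 us um small_eta.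
(* Since [s <= sigma], finiteness of Y gives that of X, so X can be cancelled. *)
have le_s : (fun_hnorm s (u t) <= 1%:E * fun_hnorm sigma (u t))%E.
  apply: le_hnorm => // k; rewrite expr1n mul1r ler_wpM2r ?sqr_ge0//.
  by rewrite ler_powR// lerDl sqr_ge0.
have inv : (fun_hnorm s (u t) <=
    c1%:E * hnorm (s + p)%R (opSD kpow N alpha T (fun t' => u (t + t')%R)))%E.
  apply: hnorm_le_duhamel; first by rewrite fourier_mean um mulr0.
  by move=> k; rewrite -(duhamel t k us T0) periodic_fourier.
have X0 : fun_hnorm s (u t) != 0%E by apply/eqP => /hnorm0P.
have Xge : (0 <= fun_hnorm s (u t))%E by exact: hnorm_ge0.
have Yge : (0 <= fun_hnorm sigma (u t))%E by exact: hnorm_ge0.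
have : (fun_hnorm s (u t) <=
    c1%:E * (c%:E * fun_hnorm s (u t) * fun_hnorm sigma (u t) `^ q))%E.
  by apply: le_trans inv _; apply: lee_wpmul2l => //; rewrite lee_fin ltW.
move: small fin le_s X0 Xge Yge; rewrite mul1e.
move: (fun_hnorm sigma (u t)) => [y| |] //.
move: (fun_hnorm s (u t)) => [x| |] //.
rewrite lte_fin lt_min => /andP[_ ysmall] _ _ x0 xge yge.
rewrite poweR_EFin -!EFinM !lee_fin in xge yge *.
have {}x0 : 0 < x by rewrite lt_neqAle xge andbT eq_sym.
apply/negP; rewrite -ltNge.
have cc : 0 < c1 * c by rewrite mulr_gt0.
have yq : y `^ q < (c1 * c)^-1.
  have : y `^ q < ((c1 * c)^-1 `^ q^-1) `^ q.
    by apply: gt0_ltr_powR => //; rewrite nnegrE// powR_ge0.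
  by rewrite -powRrM mulVf ?gt_eqF// powRr1// invr_ge0 ltW.
have -> : c1 * (c * x * y `^ q) = (c1 * c * y `^ q) * x by ring.
by rewrite -[ltRHS]mul1r ltr_pM2r// mulrC -ltr_pdivlMr// mul1r.
Qed.

End LowerBound.

(** * Uniformity over parameters and periods, and the two claims *)

Lemma period_set_lower_bound (R : realType) (K : scalars) (M : nat)
    (kpow : 'I_M -> int -> R) (Z : set ('I_M -> R))
    (N : (R -> R[i]) -> @pdistr R) (T1 T2 d p sigma q s c eta : R) (W : set R) :
  0 < T1 -> d < T2 - T1 -> 0 <= p -> 0 < q -> 0 < c -> 0 < eta -> s <= sigma ->
  period_set kpow Z T1 T2 p d W ->
  (forall alpha T, Z alpha -> W T ->
    duhamel_estimate kpow K sigma N p q s c eta alpha T) ->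
  exists r0 : R, 0 < r0 /\
    forall alpha T (u : R -> R -> R[i]), Z alpha -> W T ->
      nontrivial u -> mean_zero u ->
      time_periodic_solution kpow K sigma N alpha T u ->
      (r0%:E <= inf_norm sigma T u)%E.
Proof.
move=> T1_gt0 dT hp hq hc heta s_sigma.
move=> [W_itv _ W_large ker [c1 hc1 small_div]] est.
have W_gt0 T : W T -> 0 < T.
  by move=> /W_itv; rewrite /= in_itv /= => /andP[/(lt_le_trans T1_gt0)].
(* The threshold involves neither [alpha] nor [T], because [c1] is uniform over the period set. *)
exists (norm_threshold q c eta c1); split; first exact: norm_threshold_gt0.
move=> alpha T u Za WT unt um uper.
have T0 := W_gt0 _ WT.
have kerT := ker _ _ Za WT.
(* [d < T2 - T1] makes the measure of [W] positive; the resulting [a] lies in [W], so the estimate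
   holds at time [a] too. *)
have [|a Wa irr] := irrational_scaled_exists (W := W) T0.
  by apply: le_lt_trans W_large; rewrite lee_fin subr_ge0 ltW.
apply: le_ereal_inf_tmp => _ [t _ <-].
apply: (nonvanishing_norm_ge hp hq hc s_sigma T0 kerT
  (est _ _ Za WT) hc1 _ uper um).
  by move=> k k0; exact: small_div.
exact: (nontrivial_periodic_nonvanishing heta T0 kerT (est _ _ Za Wa)
  (W_gt0 _ Wa) irr uper um unt).
Qed.

Theorem theorem4 (R : realType) (K : scalars) (M : nat)
    (r : 'I_M -> R) (kpow : 'I_M -> int -> R) (Zm : 'I_M -> set R)
    (N : (R -> R[i]) -> @pdistr R)
    (T1 T2 delta p ptilde q s c eta : R) (W : R -> set R)
    (hT1 : 0 < T1) (hT12 : T1 < T2)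
    (hdelta : 0 < delta) (hdelta' : delta < T2 - T1)
    (hA : dispersion_hypotheses r kpow Zm)
    (hp : 1 < p) (hptilde : 0 <= ptilde) (hq : 0 < q) (hs : 0 <= s)
    (hc : 0 < c) (heta : 0 < eta)
    (hW : forall d, 0 < d -> d < T2 - T1 ->
      period_set kpow (box Zm) T1 T2 p d (W d))
    (hmean : preserves_mean kpow K (s + ptilde) N (box Zm)) :
  ((forall alpha T, box Zm alpha -> W delta T ->
      duhamel_estimate kpow K (s + ptilde) N p q s c eta alpha T) ->
   exists r0 : R, 0 < r0 /\
     forall alpha T (u : R -> R -> R[i]), box Zm alpha -> W delta T ->
       smooth u -> nontrivial u -> mean_zero u ->
       time_periodic_solution kpow K (s + ptilde) N alpha T u ->
       (r0%:E <= inf_norm (s + ptilde) T u)%E)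
  /\
  ((forall alpha T, box Zm alpha -> union_period_set T1 T2 W T ->
      duhamel_estimate kpow K (s + ptilde) N p q s c eta alpha T) ->
   forall T, union_period_set T1 T2 W T ->
   exists r0 : R, 0 < r0 /\
     forall alpha (u : R -> R -> R[i]), box Zm alpha ->
       nontrivial u -> mean_zero u ->
       time_periodic_solution kpow K (s + ptilde) N alpha T u ->
       (r0%:E <= inf_norm (s + ptilde) T u)%E).
Proof.
(* Both claims are instances of this bound, at [d = delta] and at [d = (T2 - T1) / n]. *)
have bound d : 0 < d -> d < T2 - T1 ->
    (forall alpha T, box Zm alpha -> W d T ->
      duhamel_estimate kpow K (s + ptilde) N p q s c eta alpha T) ->
    exists r0 : R, 0 < r0 /\
      forall alpha T (u : R -> R -> R[i]), box Zm alpha -> W d T ->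
        nontrivial u -> mean_zero u ->
        time_periodic_solution kpow K (s + ptilde) N alpha T u ->
        (r0%:E <= inf_norm (s + ptilde) T u)%E.
  move=> d0 dT.
  apply: (period_set_lower_bound hT1 dT _ hq hc heta _ (hW d d0 dT)).
    exact/ltW/(lt_trans ltr01).
  by rewrite lerDl.
split=> [est|est T [n /= n2 WT]].
  have [r0 [r0_gt0 r0_le]] := bound _ hdelta hdelta' est.
  by exists r0; split=> // alpha T u Za WT _; exact: r0_le.
(* Here [T] lies in the [n]-th set of the union, and [n >= 2] makes [(T2 - T1) / n] smaller than
   [T2 - T1]; [r0] depends on [T] through [n]. *)
have T12 : 0 < T2 - T1 by rewrite subr_gt0.
have n0 : 0 < n%:R :> R by rewrite ltr0n (leq_trans _ n2).
have d0 : 0 < (T2 - T1) / n%:R by rewrite divr_gt0.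
have dT : (T2 - T1) / n%:R < T2 - T1.
  by rewrite ltr_pdivrMr// ltr_pMr// ltr1n.
have [|r0 [r0_gt0 r0_le]] := bound _ d0 dT.
  by move=> alpha T' Za WT'; apply: est => //; exists n.
by exists r0; split=> // alpha u Za; exact: r0_le.
Qed.
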